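(* There is an absolute constant $\alpha$ such that the following holds. Let $H$ be a graph on $r\ge 3$ vertices, $\varepsilon\in(0,1/2]$, and $\ell=\alpha r^3+\lceil\varepsilon^{-20}\rceil$. If $G$ (with maximum degree $d$) is $H$-minor-free, then the algorithm IsMinorFree$(G,\varepsilon,H)$ outputs ACCEPT with probability at least $2/3$.
   Context: $G=(V,E)$, $|V|=n$, maximum degree $d$, accessed by neighbor queries. The lazy random walk: from vertex $v$ of degree $d_v$, move to each neighbor with probability $1/(2d)$ and stay at $v$ with probability $1-d_v/(2d)$. Algorithm IsMinorFree$(G,\varepsilon,H)$: (1) pick a multiset $S$ of $\ell^{21}$ uniformly random vertices; (2) for every $s\in S$ run EstClip$(s)$ and LocalSearch$(s)$; (3) if any call to LocalSearch returns FOUND, REJECT; (4) if more than $2\ell^{20}$ calls to EstClip return LOW, REJECT; (5) otherwise ACCEPT. LocalSearch$(s)$: perform $\ell^{21}$ independent lazy random walks of length $\ell^{11}$ from $s$, let $B_s$ be the set of all vertices encountered, determine the induced subgraph $G[B_s]$, and return FOUND iff $G[B_s]$ contains an $H$-minor (decided by an exact minor-finding algorithm). EstClip$(s)$: perform $w=\ell^{14}$ independent lazy random walks of length $\ell$ from $s$; for every vertex $v$ let $w_v$ be the number of walks ending at $v$; let $T=\{v: w_v\ge \ell^7/2\}$; output HIGH if $\sum_{v\in T}w_v\ge w/3$, else LOW. *)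

(* Defs.v *)
From HB Require Import structures.
From mathcomp Require Import all_boot all_order all_algebra.
From mathcomp Require Import reals.

Set Implicit Arguments.
Unset Strict Implicit.
Unset Printing Implicit Defensive.

Import Order.TTheory GRing.Theory Num.Theory.
Local Open Scope ring_scope.

Record sgraph := SGraph {
  svertex :> finType;
  sedge : rel svertex;
  sedge_sym : symmetric sedge;
  sedge_irr : irreflexive sedge }.

Definition degree (G : sgraph) (v : G) : nat := #|[set u | sedge v u]|.

Definition max_degree (G : sgraph) : nat := (\max_(v : G) degree v)%N.

Section Induced.
Variables (G : sgraph) (B : {set G}).

Definition induced_edge : rel {x : G | x \in B} :=
  fun x y => sedge (val x) (val y).

Lemma induced_edge_sym : symmetric induced_edge.
Proof. by move=> x y; rewrite /induced_edge sedge_sym. Qed.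

Lemma induced_edge_irr : irreflexive induced_edge.
Proof. by move=> x; rewrite /induced_edge sedge_irr. Qed.

Definition induced : sgraph := SGraph induced_edge_sym induced_edge_irr.

End Induced.

Definition connected_set (G : sgraph) (B : {set G}) : bool :=
  (B != set0) &&
  [forall x in B, forall y in B,
     connect [rel u v | [&& u \in B, v \in B & sedge u v]] x y].

(* [phi x] is the branch set of the vertex [x] of [H]: contracting each branch
   set to a vertex and deleting superfluous vertices and edges of [G] gives
   [H]. *)
Definition minor_model (H G : sgraph) (phi : {ffun H -> {set G}}) : bool :=
  [&& [forall x, connected_set (phi x)],
      [forall x, forall y, (x != y) ==> [disjoint phi x & phi y]] &
      [forall x, forall y, sedge x y ==>
         [exists u in phi x, exists v in phi y, sedge u v]]].

Definition has_minor (H G : sgraph) : bool :=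
  [exists phi : {ffun H -> {set G}}, minor_model phi].

Definition minor_free (H G : sgraph) : bool := ~~ has_minor H G.

Record fdist (R : realType) (T : finType) := FDist {
  mass :> T -> R;
  mass_ge0 : forall x, 0 <= mass x;
  mass_sum1 : \sum_x mass x = 1 }.

Section Distributions.
Variable R : realType.

Section Ret.
Variables (T : finType) (a : T).

Definition ret_mass (x : T) : R := (x == a)%:R.

Lemma ret_mass_ge0 x : 0 <= ret_mass x.
Proof. exact: ler0n. Qed.

Lemma ret_mass_sum1 : \sum_x ret_mass x = 1.
Proof.
rewrite (bigD1 a) //= /ret_mass eqxx big1 ?addr0 // => x.
by move=> /negbTE ->.
Qed.

Definition ret : fdist R T := FDist ret_mass_ge0 ret_mass_sum1.

End Ret.

Section Bind.
Variables (S T : finType) (p : fdist R S) (k : S -> fdist R T).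

Definition bind_mass (y : T) : R := \sum_x p x * k x y.

Lemma bind_mass_ge0 y : 0 <= bind_mass y.
Proof. by apply: sumr_ge0 => x _; rewrite mulr_ge0 ?mass_ge0. Qed.

Lemma bind_mass_sum1 : \sum_y bind_mass y = 1.
Proof.
rewrite /bind_mass exchange_big /= -[RHS](mass_sum1 p).
by apply: eq_bigr => x _; rewrite -mulr_sumr mass_sum1 mulr1.
Qed.

Definition bind : fdist R T := FDist bind_mass_ge0 bind_mass_sum1.

End Bind.

Section Indep.
Variables (I T : finType) (p : I -> fdist R T).

Definition indep_mass (f : {ffun I -> T}) : R := \prod_i p i (f i).

Lemma indep_mass_ge0 f : 0 <= indep_mass f.
Proof. by apply: prodr_ge0 => i _; exact: mass_ge0. Qed.

Lemma indep_mass_sum1 : \sum_f indep_mass f = 1.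
Proof.
rewrite /indep_mass -(bigA_distr_bigA (fun i x => p i x)) /=.
by rewrite big1 // => i _; exact: mass_sum1.
Qed.

(* The joint law of independent samples, the [i]-th one drawn from [p i]. *)
Definition indep : fdist R {ffun I -> T} :=
  FDist indep_mass_ge0 indep_mass_sum1.

End Indep.

Definition iid (T : finType) (n : nat) (p : fdist R T) :
  fdist R {ffun 'I_n -> T} := indep (fun=> p).

Section Uniform.
Variables (T : finType) (T_gt0 : (0 < #|T|)%N).

Definition uniform_mass (x : T) : R := #|T|%:R^-1.

Lemma uniform_mass_ge0 x : 0 <= uniform_mass x.
Proof. by rewrite invr_ge0 ler0n. Qed.

Lemma uniform_mass_sum1 : \sum_x uniform_mass x = 1.
Proof.
by rewrite sumr_const -[LHS]mulr_natr mulVf // pnatr_eq0 -lt0n.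
Qed.

Definition uniform : fdist R T := FDist uniform_mass_ge0 uniform_mass_sum1.

End Uniform.

End Distributions.

Notation "x <- p ;; q" := (bind p (fun x => q))
  (at level 100, p at next level, right associativity).

Section LazyWalk.
Variables (R : realType) (G : sgraph).

Let d := max_degree G.

(* If [d = 0] there are no edges and, as [0^-1 = 0], the walk never moves. *)
Definition lazy_step_mass (v u : G) : R :=
  if u == v then 1 - (degree v)%:R / (2 * d%:R)
  else if sedge v u then 1 / (2 * d%:R)
  else 0.

Lemma lazy_step_mass_ge0 v u : 0 <= lazy_step_mass v u.
Proof.
rewrite /lazy_step_mass; case: ifP => _; last first.
  by case: ifP => // _; rewrite divr_ge0 ?mulr_ge0 ?ler0n.
have dv : (degree v <= d)%N by exact: (leq_bigmax v).
have [d0|d0] := posnP d; first by rewrite d0 mulr0 invr0 mulr0 subr0.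
rewrite subr_ge0 ler_pdivrMr ?mul1r ?mulr_gt0 ?ltr0n //.
by rewrite -natrM ler_nat (leq_trans dv) // leq_pmull.
Qed.

Lemma lazy_step_mass_sum1 v : \sum_u lazy_step_mass v u = 1.
Proof.
rewrite (bigD1 v) //= {1}/lazy_step_mass eqxx.
have -> : \sum_(u | u != v) lazy_step_mass v u =
          \sum_(u in [set u | sedge v u]) 1 / (2 * d%:R).
  rewrite big_mkcond [RHS]big_mkcond; apply: eq_bigr => u _ /=.
  rewrite inE /lazy_step_mass; case: eqVneq => [->|_] //=.
  by rewrite sedge_irr.
by rewrite sumr_const -[X in _ + X]mulr_natl mul1r subrK.
Qed.

Definition lazy_step (v : G) : fdist R G :=
  FDist (lazy_step_mass_ge0 v) (lazy_step_mass_sum1 v).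

(* The [L] successive positions after the start vertex [v]: the trajectory is
   [v :: t] and the walk ends at [last v t]. *)
Fixpoint lazy_walk (L : nat) (v : G) : fdist R (L.-tuple G) :=
  if L is L'.+1 then
    u <- lazy_step v ;;
    t <- lazy_walk L' u ;;
    ret R [tuple of u :: t]
  else ret R [tuple].

End LazyWalk.

Definition FOUND : bool := true.
Definition NOT_FOUND : bool := false.
Definition HIGH : bool := true.
Definition LOW : bool := false.
Definition ACCEPT : bool := true.
Definition REJECT : bool := false.

Section Algorithm.
Variables (R : realType) (ell : nat) (H G : sgraph).

Definition LocalSearch (s : G) : fdist R bool :=
  walks <- iid (ell ^ 21) (lazy_walk R (ell ^ 11) s) ;;
  let B := [set v | [exists i, v \in s :: walks i]] in
  ret R (if has_minor H (induced B) then FOUND else NOT_FOUND).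

Definition EstClip (s : G) : fdist R bool :=
  let w := (ell ^ 14)%N in
  walks <- iid w (lazy_walk R ell s) ;;
  let wt (v : G) := #|[set i | last s (walks i) == v]| in
  let T := [set v | (ell ^ 7)%:R / 2 <= (wt v)%:R :> R] in
  ret R (if w%:R / 3 <= (\sum_(v in T) wt v)%:R :> R then HIGH else LOW).

(* Every occurrence [S i] of a vertex in the multiset gets its own calls, with
   fresh randomness; the pair records the answers of the two procedures. *)
Definition IsMinorFree (G_gt0 : (0 < #|G|)%N) : fdist R bool :=
  S <- iid (ell ^ 21) (uniform R G_gt0) ;;
  answers <- indep (fun i => c <- EstClip (S i) ;;
                             f <- LocalSearch (S i) ;;
                             ret R (c, f)) ;;
  ret R (if [exists i, (answers i).2 == FOUND] then REJECT
         else if (2 * ell ^ 20 < #|[set i | (answers i).1 == LOW]|)%N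
         then REJECT
         else ACCEPT).

End Algorithm.

Definition ell_param (R : realType) (alpha r : nat) (eps : R) : nat :=
  (alpha * r ^ 3 + `|Num.ceil (eps ^- 20)|)%N.

(* Main.v *)
(* An H-minor-free graph has no r disjoint, connected, pairwise adjacent vertex
   sets (r = |H|). As in Alon, Seymour and Thomas, growing such a family next to
   a large part B of a vertex set W with |W| <= t^2 ends with a set of at most
   r^2 t vertices cutting W into pieces of at most |W|/2 vertices. Repeated
   halving then gives, for every q > 0, a set X with |X| <= 8 r^2 n / q whose
   removal leaves components of at most q^2 vertices; take q = ell^3.

   A walk of length ell avoiding X ends in the component C of its start s, and
   |C| <= ell^6. The clipping threshold discards at most ell^7/2 walk ends per
   vertex of C, hence at most half of ell^13 <= w/3 in total, so LOW at s forces
   at least w/2 visits to X. The uniform distribution being stationary, a walk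
   from a uniform start makes (ell+1)|X|/n expected visits to X, so Markov's
   inequality (applied to the visits, then to the number of LOW answers) bounds
   the probability of rejection by ell(ell+1)|X|/n. LocalSearch never answers
   FOUND, because minors of induced subgraphs are minors of G. *)
Require Import Defs.
From mathcomp Require Import all_boot all_order all_algebra.
From mathcomp Require Import reals.
From mathcomp Require Import zify ring lra.

Set Implicit Arguments.
Unset Strict Implicit.
Unset Printing Implicit Defensive.

(** * Separators and hyperfiniteness of minor-free graphs *)

Section Connectivity.
Variable G : sgraph.
Implicit Types (B C F U W X Y Z : {set G}) (u v w x y : G).

Definition edge_in B : rel G := fun u v => [&& u \in B, v \in B & sedge u v].

Lemma edge_in_sym B : connect_sym (edge_in B).
Proof.
apply: sym_connect_sym => u v; rewrite /edge_in /= sedge_sym.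
by case: (u \in B); case: (v \in B).
Qed.

Lemma connected_setP B :
  reflect (B != set0 /\ {in B &, forall x y, connect (edge_in B) x y})
          (connected_set B).
Proof.
apply: (iffP andP) => -[B0 cB]; split=> //.
  by move=> x y Bx By; move/forall_inP: cB => /(_ x Bx) /forall_inP; apply.
by apply/forall_inP => x Bx; apply/forall_inP => y; apply: cB.
Qed.

Lemma connected_from B x :
  x \in B -> {in B, forall y, connect (edge_in B) x y} -> connected_set B.
Proof.
move=> Bx cB; apply/connected_setP; split; first by apply/set0Pn; exists x.
by move=> y z By Bz; apply: connect_trans (cB z Bz); rewrite edge_in_sym cB.
Qed.

(** The form in which connectivity is used below: to confine a connected set, it suffices to check
    one vertex and single edges. *)
Lemma connected_sub_closed F x (P : {set G}) :
    connected_set F -> x \in F -> x \in P ->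
    {in F &, forall u v, u \in P -> sedge u v -> v \in P} ->
  F \subset P.
Proof.
move=> /connected_setP[_ cF] Fx Px clP; apply/subsetP => y Fy.
have /connectP[p] := cF x y Fx Fy.
elim: p x Fx Px => [|z p IHp] x Fx Px /=; first by move=> _ ->.
by case/andP=> /and3P[_ Fz xz] pp yE; apply: (IHp z) => //; apply: clP xz.
Qed.

Lemma connect_edge_inS B C x y :
  B \subset C -> connect (edge_in B) x y -> connect (edge_in C) x y.
Proof.
move=> sBC; apply: connect_sub => u v /and3P[Bu Bv uv].
by apply: connect1; rewrite /edge_in !(subsetP sBC) ?uv.
Qed.

Lemma connected_set1 v : connected_set [set v].
Proof.
apply: (@connected_from _ v); first by rewrite set11.
by move=> y /set1P ->.
Qed.

Lemma connected_setU1 U u v :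
  connected_set U -> v \in U -> sedge v u -> connected_set (u |: U).
Proof.
move=> /connected_setP[_ cU] Uv vu.
apply: (@connected_from _ v) => [|y]; first by rewrite !inE Uv orbT.
rewrite in_setU1 => /predU1P[->|Uy].
  by apply: connect1; rewrite /edge_in !inE Uv eqxx orbT vu.
exact: connect_edge_inS (subsetUr _ _) (cU _ _ Uv Uy).
Qed.

(** No [edge_in Y] step starts outside [Y], so for [v \notin Y] the value is [[set v]]; hence the
    hypothesis [v \in Y] in the lemmas below. *)
Definition component Y v : {set G} := [set u | connect (edge_in Y) v u].

Lemma mem_component Y v : v \in component Y v. Proof. by rewrite inE connect0. Qed.

Lemma component_edge Y v u w :
  v \in Y -> u \in component Y v -> w \in Y -> sedge u w -> w \in component Y v.
Proof.
rewrite !inE => Yv /[dup] vu /connectP[p pp uE] Yw uw.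
have Yu : u \in Y.
  case/lastP: p pp uE => [|p z]; first by move=> _ ->.
  by rewrite rcons_path last_rcons => /andP[_ /and3P[_ Yz _]] ->.
by apply: connect_trans vu (connect1 _); rewrite /edge_in Yu Yw.
Qed.

Lemma component_sub Y v : v \in Y -> component Y v \subset Y.
Proof.
move=> Yv; apply/subsetP => u; rewrite inE => /connectP[p + ->].
elim: p v Yv => [|z p IHp] v Yv //= /andP[/and3P[_ Yz _]]; exact: IHp.
Qed.

Lemma connected_sub_component F Y v :
  v \in Y -> connected_set F -> F \subset Y -> ~~ [disjoint F & component Y v] ->
  F \subset component Y v.
Proof.
move=> Yv cF sFY /pred0Pn[x /andP[Fx Cx]].
apply: connected_sub_closed cF Fx Cx _ => u w Fu Fw Cu uw.
by apply: component_edge Cu _ uw => //; apply: (subsetP sFY).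
Qed.

Lemma component_connected Y v : v \in Y -> connected_set (component Y v).
Proof.
move=> Yv; apply: connected_from (mem_component Y v) _ => u.
rewrite inE => /connectP[p pp ->]; move: pp (mem_component Y v).
(* Only the start of the path is generalized; the component stays that of the original [v]. *)
move: {1 2 5 6}v; elim: p => [|z p IHp] x //= /andP[/and3P[_ Yz xz]] pp Cx.
have Cz : z \in component Y v by apply: component_edge Cx Yz xz.
apply: connect_trans (IHp _ pp Cz); apply: connect1.
by rewrite /edge_in Cx Cz.
Qed.

Definition adj U C := [exists u in U, exists c in C, sedge u c].

Lemma adjP U C :
  reflect (exists u c, [/\ u \in U, c \in C & sedge u c]) (adj U C).
Proof.
apply: (iffP exists_inP) => [[u Uu /exists_inP[c Cc uc]]|[u [c [Uu Cc uc]]]].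
  by exists u, c.
by exists u => //; apply/exists_inP; exists c.
Qed.

Lemma adjC : symmetric adj.
Proof.
move=> U C; apply/adjP/adjP => -[u [c [? ? uc]]];
  by exists c, u; rewrite sedge_sym.
Qed.

Lemma adjS U U' C : U \subset U' -> adj U C -> adj U' C.
Proof.
move=> /subsetP sU /adjP[u [c [Uu Cc uc]]].
by apply/adjP; exists u, c; rewrite sU.
Qed.

Lemma sum_increments (B : nat -> {set G}) W t :
    (forall m, B m \subset B m.+1) -> (forall m, B m \subset W) ->
  \sum_(m < t) #|B m.+1 :\: B m| <= #|W|.
Proof.
move=> sB sBW; apply: (@leq_trans #|B t|); last exact: subset_leq_card.
elim: t => [|t IHt]; first by rewrite big_ord0.
rewrite big_ord_recr /=.
by rewrite -(cardsID (B t) (B t.+1)) (setIidPr (sB t)) leq_add2r.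
Qed.

(* [R i m] collects the vertices of [B] lying in a connected subset of [B] of
   size at most [m.+1] that touches the first [i] sets of [Cs]. The layers
   [R i m.+1 :\: R i m] are disjoint for distinct [m], so for some [m < t] those
   of all [i] together are small; a connected set avoiding them and touching
   all of [Cs] lies in each [R i m] in turn. *)
Lemma short_connector_or_cut B (Cs : seq {set G}) t :
    0 < t ->
  (exists U, [/\ U \subset B, connected_set U, #|U| <= t & all (adj U) Cs]) \/
  (exists Z, [/\ Z \subset B, t * #|Z| <= size Cs * #|B| &
     forall F, connected_set F -> F \subset B :\: Z ->
       exists2 C, C \in Cs & ~~ adj F C]).
Proof.
move=> t0.
pose R i m := [set v in B | [exists U : {set G}, [&& U \subset B,
   connected_set U, #|U| <= m.+1, v \in U & all (adj U) (take i Cs)]]].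
have RP i m v : reflect (v \in B /\ exists U : {set G}, [/\ U \subset B,
   connected_set U, #|U| <= m.+1, v \in U & all (adj U) (take i Cs)])
   (v \in R i m).
  rewrite inE; apply: (iffP andP) => -[Bv].
    by move=> /existsP[U /and5P[? ? ? ? ?]]; split=> //; exists U.
  by case=> U HU; split=> //; apply/existsP; exists U; apply/and5P.
have RB i m : R i m \subset B by apply/subsetP => v /RP[].
have RS i m : R i m \subset R i m.+1.
  apply/subsetP => v /RP[Bv [U [? ? Um ? ?]]]; apply/RP; split=> //.
  by exists U; split=> //; apply: leq_trans Um _.
case: (boolP [exists U : {set G}, [&& U \subset B, connected_set U,
                                    #|U| <= t & all (adj U) Cs]]).
  by case/existsP=> U /and4P[? ? ? ?]; left; exists U.
move=> /existsPn noU; right.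
pose Zm m := \bigcup_(i < size Cs) (R i.+1 m.+1 :\: R i.+1 m).
have sumZ : \sum_(m < t) #|Zm m| <= size Cs * #|B|.
  apply: (@leq_trans (\sum_(m < t) \sum_(i < size Cs)
                        #|R i.+1 m.+1 :\: R i.+1 m|)).
    apply: leq_sum => m _; rewrite /Zm.
    apply: (big_ind2 (fun (x : {set G}) n => #|x| <= n)) => //.
      by rewrite cards0.
    move=> x1 n1 x2 n2 h1 h2; apply: leq_trans (leq_card_setU _ _) _.
    exact: leq_add.
  rewrite exchange_big /= -[X in _ <= X * _]card_ord -sum_nat_const.
  by apply: leq_sum => i _; apply: (sum_increments (B := R i.+1)).
(* Averaging: the smallest of the [t] sets [Zm m] is at most their mean. *)
have [m mt Hm] : exists2 m : nat, m < t & t * #|Zm m| <= size Cs * #|B|.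
  case: (boolP [exists m : 'I_t, t * #|Zm m| <= size Cs * #|B|]).
    by case/existsP=> m Hm; exists m.
  move=> /existsPn big; exfalso.
  have: \sum_(m < t) (size Cs * #|B|).+1 <= \sum_(m < t) t * #|Zm m|.
    by apply: leq_sum => m _; rewrite ltnNge big.
  rewrite -big_distrr /= sum_nat_const card_ord leq_pmul2l // => h.
  by move: (leq_trans h sumZ); rewrite ltnn.
exists (Zm m); split=> //.
  apply/bigcupsP => i _; apply: subset_trans (subsetDl _ _) (RB _ _).
move=> F cF; rewrite subsetD => /andP[sFB dFZ].
apply/hasP; rewrite has_predC; apply/negP => aF.
have [/set0Pn[x0 Fx0] _] := connected_setP _ cF.
(* Singletons put all of [B] into [R 0 m]. For the step, a vertex of [F] next to the new set enters
   [R i.+1 m]; its neighbours in [F] enter [R i.+1 m.+1], hence [R i.+1 m], since [F] avoids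
   [Zm m]. *)
have FR i : i <= size Cs -> F \subset R i m.
  elim: i => [_|i IHi lti].
    apply/subsetP => v Fv; have Bv := subsetP sFB v Fv; apply/RP; split=> //.
    exists [set v]; rewrite sub1set take0 Bv connected_set1 cards1 set11.
    by split.
  have [v [c [Fv Cc vc]]] : exists v c,
      [/\ v \in F, c \in nth set0 Cs i & sedge v c].
    by apply/adjP; move/all_nthP: aF; apply.
  have Rv : v \in R i.+1 m.
    have /RP[Bv [U [sU cU Um Uv aU]]] := subsetP (IHi (ltnW lti)) v Fv.
    apply/RP; split=> //; exists U; split=> //.
    rewrite (take_nth set0) // all_rcons aU andbT.
    by apply/adjP; exists v, c.
  apply: (connected_sub_closed cF Fv Rv) => u w Fu Fw /RP[Bu [U [sU cU Um Uu aU]]] uw.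
  have Bw : w \in B by apply: (subsetP sFB).
  have Rw : w \in R i.+1 m.+1.
    apply/RP; split=> //; exists (w |: U); split.
    - by rewrite subUset sub1set Bw.
    - exact: connected_setU1 cU Uu uw.
    - by rewrite cardsU1; case: (_ \notin _) => //=; apply: leqW.
    - exact: setU11.
    - by apply: sub_all aU => C; apply/adjS/subsetUr.
  have: w \notin Zm m by rewrite (disjointFr dFZ Fw).
  apply: contraNT => nRw; apply/bigcupP; exists (Ordinal lti) => //=.
  by rewrite inE nRw.
have /RP[_ [U [sU cU Um _ aU]]] := subsetP (FR _ (leqnn _)) x0 Fx0.
move: (noU U); rewrite sU cU (leq_trans Um mt).
by rewrite -[Cs in all _ Cs](take_size Cs) aU.
Qed.

End Connectivity.

(** * Coveys and balanced separators *)

Section Separator.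
Variable G : sgraph.
Implicit Types (B C D F U W X Y Z : {set G}) (P : {set {set G}}) (u v w : G).

(** A model of the complete graph on [#|P|] vertices as a minor. *)
Definition covey P :=
  {in P, forall C, connected_set C} /\
  {in P &, forall C D, C != D -> [disjoint C & D] && adj C D}.

Definition attachment B C := [set c in C | adj B [set c]].

Lemma attachmentP B C c :
  reflect (c \in C /\ exists2 u, u \in B & sedge u c) (c \in attachment B C).
Proof.
rewrite inE; apply: (iffP andP) => -[Cc].
  by case/adjP=> u [_ [Bu /set1P-> uc]]; split=> //; exists u.
by case=> u Bu uc; split=> //; apply/adjP; exists u, c; rewrite set11.
Qed.

(** The invariant of the separator search: [B] holds more than half of [W], and each edge leaving
    [B] within [W] ends in the attachment of some member of [P]. Deleting the attachments, at most
    [n] vertices per member, thus isolates [B] in [W]. *)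
Definition covey_state W n B P :=
  [/\ B \subset W, #|W| < 2 * #|B|, covey P,
      {in P, forall C, [disjoint C & B] /\ #|attachment B C| <= n} &
      forall u w, u \in B -> w \in W -> w \notin B -> sedge u w ->
        exists2 C, C \in P & w \in C].

Definition halving_set W X :=
  forall F, connected_set F -> F \subset W :\: X -> 2 * #|F| <= #|W|.

(** The candidate [X] is [Y] together with all attachments. A connected set avoiding it cannot cross
    the boundary of [B]: outside [B] it has less than half of [W], and inside [B] it lies in one
    component of [B :\: Y]. *)
Lemma covey_state_cut W n B P Y :
    covey_state W n B P -> #|Y| <= n ->
  (exists2 X, halving_set W X & #|X| <= #|P|.+1 * n) \/
  (exists2 v, v \in B :\: Y & #|W| < 2 * #|component (B :\: Y) v|).
Proof.
move=> [sBW Bbig cP attP bdP] Yn.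
have [/exists_inP[v vB big]|/exists_inPn small] := boolP
  [exists v in B :\: Y, #|W| < 2 * #|component (B :\: Y) v|].
  by right; exists v.
left; exists (\bigcup_(C in P) attachment B C :|: Y); last first.
  apply: leq_trans (leq_card_setU _ _) _; rewrite mulSn addnC leq_add //.
  rewrite -sum_nat_const; apply: (@leq_trans (\sum_(C in P) #|attachment B C|)).
    apply: (big_ind2 (fun (x : {set G}) m => #|x| <= m)) => //.
      by rewrite cards0.
    move=> x1 n1 x2 n2 h1 h2; apply: leq_trans (leq_card_setU _ _) _.
    exact: leq_add.
  by apply: leq_sum => C /attP[].
move=> F cF; rewrite subsetD => /andP[sFW dFX].
have [dFB|/pred0Pn[x /andP[/= Fx Bx]]] := boolP [disjoint F & B].
  have: #|F :|: B| <= #|W| by rewrite subset_leq_card // subUset sFW.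
  rewrite cardsU disjoint_setI0 // cards0 subn0; lia.
have sFB : F \subset B.
  apply: connected_sub_closed cF Fx Bx _ => u w Fu Fw Bu uw.
  apply: contraT => nBw.
  have [C PC Cw] := bdP u w Bu (subsetP sFW w Fw) nBw uw.
  suff: w \in \bigcup_(C in P) attachment B C :|: Y by rewrite (disjointFr dFX Fw).
  rewrite inE; apply/orP; left; apply/bigcupP; exists C => //.
  by apply/attachmentP; split=> //; exists u.
have sFBY : F \subset B :\: Y.
  rewrite subsetD sFB; apply: disjointWr dFX; exact: subsetUr.
have xBY := subsetP sFBY x Fx.
apply: leq_trans (_ : 2 * #|component (B :\: Y) x| <= _).
  rewrite leq_pmul2l // subset_leq_card //; apply: connected_sub_component => //.
  by apply/pred0Pn; exists x; rewrite /= Fx mem_component.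
by have := small x xBY; rewrite -leqNgt.
Qed.

(** A small connector [U] joins the covey and [B] shrinks to the large component left. The
    attachment in [U] is small because [U] is, and removing [U] creates boundary edges only towards
    [U]. *)
Lemma covey_add W n B P U v :
    covey_state W n B P -> U \subset B -> connected_set U -> #|U| <= n ->
    {in P, forall C, adj U C} ->
    v \in B :\: U -> #|W| < 2 * #|component (B :\: U) v| ->
  covey_state W n (component (B :\: U) v) (U |: P).
Proof.
move=> [sBW Bbig [cP pP] attP bdP] sUB cU Un aU vB big.
have sB' := component_sub vB.
have sB'B : component (B :\: U) v \subset B by apply: subset_trans sB' (subsetDl _ _).
split=> //; first exact: subset_trans sBW.
- split=> [C|C D]; first by case/setU1P=> [->|/cP].
  have dUP E : E \in P -> [disjoint U & E] && adj U E.
    move=> PE; rewrite aU // andbT disjoint_sym.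
    by have [dE _] := attP E PE; apply: disjointWr dE.
  case/setU1P=> [->|PC]; case/setU1P=> [->|PD].
  + by rewrite eqxx.
  + by move=> _; apply: dUP.
  + by move=> _; rewrite disjoint_sym adjC dUP.
  + exact: pP.
- move=> C /setU1P[->|PC].
    split.
      by move: sB'; rewrite subsetD disjoint_sym => /andP[].
    apply: leq_trans Un; apply: subset_leq_card.
    by apply/subsetP => c /attachmentP[].
  have [dC aC] := attP C PC; split; first exact: disjointWr dC.
  apply: leq_trans aC; apply: subset_leq_card; apply/subsetP => c.
  case/attachmentP=> Cc [u B'u uc]; apply/attachmentP; split=> //.
  by exists u => //; apply: (subsetP sB'B).
- move=> u w B'u Ww nB'w uw.
  have [Uw|nUw] := boolP (w \in U); first by exists U; rewrite ?setU11.
  have [Bw|nBw] := boolP (w \in B).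
    by case/negP: nB'w; apply: component_edge B'u _ uw; rewrite // inE nUw.
  have [C PC Cw] := bdP u w (subsetP sB'B u B'u) Ww nBw uw.
  by exists C; rewrite // setU1r.
Qed.

(* When the large component [B1] of [B :\: Z] does not touch [C], the set [C]
   grows to the component [D] of [C :|: (B :\: B1)] containing it, and [B]
   shrinks to the component of [B :\: D] containing [B1]; every edge between
   the two new sets then has its end in [D] inside [Z]. *)
Lemma covey_grow W n B P Z C v :
    covey_state W n B P -> #|Z| <= n -> C \in P -> adj B C ->
    v \in B :\: Z -> #|W| < 2 * #|component (B :\: Z) v| ->
    ~~ adj (component (B :\: Z) v) C ->
  exists B' D, covey_state W n B' (D |: (P :\ C)) /\ #|B'| < #|B|.
Proof.
move=> [sBW Bbig [cP pP] attP bdP] Zn PC aBC vB big naC.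
set B1 := component (B :\: Z) v in big naC.
have sB1 : B1 \subset B :\: Z := component_sub vB.
have sB1B : B1 \subset B by apply: subset_trans sB1 (subsetDl _ _).
have B1v : v \in B1 by exact: mem_component.
have [dCB _] := attP C PC.
have [a [c [Ba Cc ac]]] := adjP _ _ aBC.
pose E := C :|: (B :\: B1).
have Ec : c \in E by rewrite inE Cc.
pose D := component E c.
have sDE : D \subset E := component_sub Ec.
have sCD : C \subset D.
  apply: connected_sub_component => //; [exact: cP | exact: subsetUl |].
  by apply/pred0Pn; exists c; rewrite /= Cc mem_component.
(* The neighbour [a] of [C] passes from [B] to [D], which makes [B'] strictly smaller than [B]. *)
have nB1a : a \notin B1.
  by apply: contra naC => B1a; apply/adjP; exists a, c.
have Da : a \in D.
  apply: (component_edge Ec (mem_component _ _)); last by rewrite sedge_sym.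
  by rewrite /E in_setU in_setD Ba nB1a orbT.
have dDB1 : [disjoint B1 & D].
  apply: disjointWr sDE _; rewrite /E disjoint_sym disjoints_subset.
  rewrite subUset; apply/andP; split.
    by rewrite -disjoints_subset; apply: disjointWr dCB.
  by rewrite setDE subsetIr.
have sB1BD : B1 \subset B :\: D by rewrite subsetD sB1B.
have BDv : v \in B :\: D := subsetP sB1BD v B1v.
pose B' := component (B :\: D) v.
have sB' : B' \subset B :\: D := component_sub BDv.
have sB'B : B' \subset B by apply: subset_trans sB' (subsetDl _ _).
have sB1B' : B1 \subset B'.
  apply: connected_sub_component => //; first exact: component_connected.
  by apply/pred0Pn; exists v; rewrite /= B1v mem_component.
have dB'D : [disjoint B' & D] by move: sB'; rewrite subsetD => /andP[].
have sDCB : D \subset C :|: B by apply: subset_trans sDE _; rewrite setUS ?subsetDl.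
have disjD X : X \in P -> X != C -> [disjoint D & X].
  move=> PX nXC; apply: disjointWl sDCB _; rewrite disjoint_sym.
  rewrite disjoints_subset setCU subsetI -!disjoints_subset.
  by have /andP[-> _] := pP X C PX PC nXC; case: (attP X PX).
exists B', D; split; last first.
  apply: proper_card; apply/properP; split=> //; exists a => //.
  by rewrite (disjointFl dB'D).
split.
- exact: subset_trans sBW.
- by apply: leq_trans big _; rewrite leq_pmul2l // subset_leq_card.
- split=> [X|X Y]; first by case/setU1P=> [->|/setD1P[_ /cP]] //; apply: component_connected.
  have DP X' : X' \in P -> X' != C -> [disjoint D & X'] && adj D X'.
    move=> PX nXC; rewrite disjD //=; apply: adjS sCD _.
    by rewrite eq_sym in nXC; have /andP[] := pP C X' PC PX nXC.
  case/setU1P=> [->|/setD1P[nX PX]]; case/setU1P=> [->|/setD1P[nY PY]].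
  + by rewrite eqxx.
  + by move=> _; apply: DP.
  + by move=> _; rewrite disjoint_sym adjC DP.
  + exact: pP.
- move=> X /setU1P[->|/setD1P[_ PX]].
    split; first by rewrite disjoint_sym.
    (* An edge from [u] in [B'] to [w] in [D] has [u] in [B1], or else [D] would absorb [u]. Then
       [w] is neither in [C], which [B1] does not touch, nor in [B1]; as [B1] is a component of
       [B :\: Z], [w] lies in [Z]. *)
    apply: leq_trans Zn; apply: subset_leq_card; apply/subsetP => w.
    case/attachmentP=> Dw [u B'u uw].
    have nDu : u \notin D by rewrite (disjointFr dB'D B'u).
    have Bu := subsetP sB'B u B'u.
    have B1u : u \in B1.
      apply: contraR nDu => nB1u.
      apply: (component_edge Ec Dw); last by rewrite sedge_sym.
      by rewrite /E in_setU in_setD nB1u Bu orbT.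
    have := subsetP sDE w Dw; rewrite /E in_setU in_setD => /orP[Cw|/andP[nB1w Bw]].
      by case/negP: naC; apply/adjP; exists u, w.
    apply: contraR nB1w => nZw; apply: (component_edge vB B1u) uw.
    by rewrite inE nZw.
  have [dX aX] := attP X PX; split; first exact: disjointWr dX.
  apply: leq_trans aX; apply: subset_leq_card; apply/subsetP => w.
  case/attachmentP=> Xw [u B'u uw]; apply/attachmentP; split=> //.
  by exists u => //; apply: (subsetP sB'B).
- move=> u w B'u Ww nB'w uw.
  have [Dw|nDw] := boolP (w \in D); first by exists D; rewrite ?setU11.
  have [Bw|nBw] := boolP (w \in B).
    by case/negP: nB'w; apply: component_edge B'u _ uw; rewrite // inE nDw.
  have [X PX Xw] := bdP u w (subsetP sB'B u B'u) Ww nBw uw.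
  exists X => //; rewrite setU1r // !inE PX andbT.
  by apply: contraNneq nDw => XC; rewrite (subsetP sCD) // -XC.
Qed.

Lemma covey_remove W n B P C :
  covey_state W n B P -> C \in P -> ~~ adj B C -> covey_state W n B (P :\ C).
Proof.
move=> [sBW Bbig [cP pP] attP bdP] PC naC; split=> //.
- split=> [X|X Y]; first by case/setD1P=> _ /cP.
  by case/setD1P=> _ PX /setD1P[_ PY]; apply: pP.
- by move=> X /setD1P[_ /attP].
- move=> u w Bu Ww nBw uw; have [X PX Xw] := bdP u w Bu Ww nBw uw.
  exists X => //; rewrite !inE PX andbT; apply: contraNneq naC => <-.
  by apply/adjP; exists u, w.
Qed.

(** The invariant is run with [n = h * t]. A connector has at most [t] vertices; a cut [Z] satisfies
    [t * #|Z| <= #|P| * #|B| <= h * t ^ 2]. The final separator has at most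
    [#|P|.+1 * n <= h ^ 2 * t] vertices. *)
Lemma separator W h t :
    0 < t -> #|W| <= t ^ 2 -> (forall P, covey P -> #|P| < h) ->
  exists2 X, halving_set W X & #|X| <= h ^ 2 * t.
Proof.
move=> t0 Wt small.
have bound P : covey P -> #|P|.+1 * (h * t) <= h ^ 2 * t.
  by move=> /small lt; rewrite expnS expn1 -mulnA leq_mul2r lt orbT.
have covey0 : covey set0 by split=> ?; rewrite inE.
have h0 : 0 < h by apply: leq_ltn_trans (small _ covey0).
have tn : t <= h * t by rewrite leq_pmull.
(* The measure [#|B| * 2 + #|P|] drops at each step: removing an untouched member lowers [#|P|],
   while the other moves shrink [B] and add at most one member. It cannot reach 0, since [B] is
   nonempty. *)
suff main m B P : #|B| * 2 + #|P| <= m -> covey_state W (h * t) B P ->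
    exists2 X, halving_set W X & #|X| <= h ^ 2 * t.
  have [/exists_inP[v Wv big]|/exists_inPn sm] := boolP
      [exists v in W, #|W| < 2 * #|component W v|].
    apply: (main _ (component W v) set0 (leqnn _)); split=> //.
    - exact: component_sub.
    - by move=> ?; rewrite inE.
    - move=> u w Cu Ww /negP nCw uw; case: nCw; exact: component_edge Cu Ww uw.
  exists set0; last by rewrite cards0.
  move=> F cF; rewrite setD0 => sFW.
  have [/set0Pn[x Fx] _] := connected_setP _ cF.
  have Wx := subsetP sFW x Fx.
  apply: leq_trans (_ : 2 * #|component W x| <= _); last by rewrite leqNgt sm.
  rewrite leq_pmul2l // subset_leq_card //; apply: connected_sub_component => //.
  by apply/pred0Pn; exists x; rewrite /= Fx mem_component.
elim: m B P => [|m IHm] B P le_m st.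
  by case: st => _; move: le_m; case: #|B|.
have [sBW _ cP attP _] := st.
have [/exists_inP[C PC naC]|/exists_inPn aBP] := boolP [exists C in P, ~~ adj B C].
  apply: (IHm _ _ _ (covey_remove st PC naC)).
  by rewrite (cardsD1 C) PC add1n addnS in le_m.
have [[U [sUB cU Ut aU]]|[Z [sZB Zn noF]]] := short_connector_or_cut B (enum P) t0.
  have UP : {in P, forall C, adj U C}.
    by move=> C PC; apply: (allP aU); rewrite mem_enum.
  have Un : #|U| <= h * t by exact: leq_trans tn.
  have [[X hX Xn]|[v vB big]] := covey_state_cut st Un.
    by exists X => //; apply: leq_trans Xn (bound _ cP).
  apply: (IHm _ _ _ (covey_add st sUB cU Un UP vB big)).
  have lt : #|component (B :\: U) v| < #|B|.
    apply: leq_ltn_trans (subset_leq_card (component_sub vB)) _.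
    rewrite cardsD (setIidPr sUB).
    have [/set0Pn U0 _] := connected_setP _ cU.
    rewrite ltn_subrL; apply/andP; split; first exact/card_gt0P.
    by apply: leq_trans (subset_leq_card sUB); apply/card_gt0P.
  by rewrite cardsU1; move: lt le_m; move: #|component _ _| #|B| #|P| => b' b p; lia.
have {}Zn : #|Z| <= h * t.
  rewrite -(leq_pmul2l t0); apply: leq_trans Zn _.
  rewrite -cardE; apply: (@leq_trans (h * t ^ 2)); last by rewrite mulnCA -mulnn.
  by apply: leq_mul; [exact: ltnW (small _ cP)|apply: leq_trans Wt; apply: subset_leq_card].
have [[X hX Xn]|[v vB big]] := covey_state_cut st Zn.
  by exists X => //; apply: leq_trans Xn (bound _ cP).
have [C] := noF _ (component_connected vB) (component_sub vB).
rewrite mem_enum => PC naC.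
have aBC : adj B C by have := aBP C PC; rewrite negbK.
have [B' [D [st' lt]]] := covey_grow st Zn PC aBC vB big naC.
apply: (IHm _ _ _ st').
rewrite (cardsD1 C P) PC in le_m; rewrite cardsU1.
by move: lt le_m; move: #|B'| #|B| #|P :\ C| => b' b p; lia.
Qed.

Lemma covey_minor (H : sgraph) P : covey P -> #|H| <= #|P| -> has_minor H G.
Proof.
move=> [cP pP] le.
pose f (x : H) := enum_val (widen_ord le (enum_rank x)).
have Pf x : f x \in P by exact: enum_valP.
have f_inj : injective f.
  by move=> x y /enum_val_inj /(congr1 val) /= /val_inj /enum_rank_inj.
apply/existsP; exists [ffun x => f x]; apply/and3P; split.
- by apply/forallP => x; rewrite ffunE cP.
- apply/forallP => x; apply/forallP => y; apply/implyP => nxy; rewrite !ffunE.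
  by have /andP[] := pP _ _ (Pf x) (Pf y) (contra_neq (@f_inj x y) nxy).
- apply/forallP => x; apply/forallP => y; apply/implyP => xy; rewrite !ffunE.
  have nxy : x != y by apply: contraTneq xy => ->; rewrite sedge_irr.
  by have /andP[] := pP _ _ (Pf x) (Pf y) (contra_neq (@f_inj x y) nxy).
Qed.

(** * Hyperfiniteness by repeated halving *)

Definition components_le Y m :=
  forall F, connected_set F -> F \subset Y -> #|F| <= m.

Lemma components_leS Y Y' m :
  Y' \subset Y -> components_le Y m -> components_le Y' m.
Proof. by move=> sY cY F cF /subset_trans-/(_ _ sY); apply: cY. Qed.

Section Hyperfinite.
Variable h : nat.
Hypothesis small_covey : forall P, covey P -> #|P| < h.

(* A component of size more than [q ^ 2] pays at most [2 * h ^ 2 / q] per vertex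
   for its separator. *)
Lemma halve_components q m Y :
    0 < q -> m <= (2 * q) ^ 2 -> components_le Y m ->
  exists2 X : {set G}, q * #|X| <= 2 * h ^ 2 * #|Y| &
    components_le (Y :\: X) (maxn (q ^ 2) m./2).
Proof.
move=> q0 mq; have [n] := ubnP #|Y|; elim: n Y => // n IHn Y /ltnSE Yn cY.
have [->|/set0Pn[v Yv]] := eqVneq Y set0.
  exists set0; rewrite ?cards0 ?muln0 // setD0 => F _.
  by rewrite subset0 => /eqP->; rewrite cards0.
have sCY := component_sub Yv; set C := component Y v in sCY.
have Cm : #|C| <= m by apply: cY; first exact: component_connected.
have [X1 X1n cX1] : exists2 X : {set G}, q * #|X| <= 2 * h ^ 2 * #|C| &
    components_le (C :\: X) (maxn (q ^ 2) m./2).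
  have [Cq|Cq] := leqP #|C| (q ^ 2).
    exists set0; rewrite ?cards0 ?muln0 // => F _ /subset_leq_card.
    by rewrite setD0 leq_max => /leq_trans-/(_ _ Cq) ->.
  (* Here [t = 2 * q] works since [#|C| <= m <= (2 * q) ^ 2]; the cost
     [q * #|X| <= 2 * h ^ 2 * q ^ 2] is charged to the more than [q ^ 2] vertices of [C]. *)
  have [||X hX Xn] := separator (W := C) (t := 2 * q) _ _ small_covey.
  - by rewrite muln_gt0.
  - exact: leq_trans mq.
  exists X => [|F cF sF].
    apply: leq_trans (_ : 2 * h ^ 2 * q ^ 2 <= _).
      apply: leq_trans (leq_mul (leqnn q) Xn) _.
      by rewrite (mulnC 2 q) (mulnC _ 2) -!mulnn !mulnA; lia.
    by rewrite leq_mul // ltnW.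
  have := leq_trans (hX F cF sF) Cm; rewrite leq_max; lia.
have lt : #|Y :\: C| < n.
  apply: leq_trans Yn; rewrite cardsD (setIidPr sCY) ltn_subrL.
  by apply/andP; split; apply/card_gt0P; exists v; rewrite // mem_component.
have [X2 X2n cX2] := IHn _ lt (components_leS (subsetDl _ _) cY).
exists (X1 :|: X2).
  apply: (@leq_trans (q * #|X1| + q * #|X2|)).
    by rewrite -mulnDr leq_mul // leq_card_setU.
  apply: leq_trans (leq_add X1n X2n) _.
  by rewrite -mulnDr leq_mul // -(cardsID C Y) (setIidPr sCY).
move=> F cF; rewrite setDUr subsetI => /andP[sF1 sF2].
have [dFC|mFC] := boolP [disjoint F & C].
  apply: cX2 => //; move: sF2; rewrite !subsetD dFC andbT => /andP[-> ->] //.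
apply: cX1 => //; move: sF1; rewrite !subsetD => /andP[sFY ->].
by rewrite andbT; apply: connected_sub_component.
Qed.

(** Two halvings take [4 * q ^ 2] to [q ^ 2], each costing [2 * h ^ 2 / q] per vertex. *)
Lemma quarter_components q Y :
    0 < q -> components_le Y ((2 * q) ^ 2) ->
  exists2 X : {set G}, q * #|X| <= 4 * h ^ 2 * #|Y| & components_le (Y :\: X) (q ^ 2).
Proof.
move=> q0 cY; have [X1 X1n cX1] := halve_components q0 (leqnn _) cY.
have [|X2 X2n cX2] := halve_components q0 _ cX1.
  by rewrite -!mulnn; lia.
exists (X1 :|: X2); last first.
  rewrite -setDDl => F cF sF; apply: leq_trans (cX2 F cF sF) _.
  by rewrite -!mulnn; lia.
apply: leq_trans (leq_mul (leqnn q) (leq_card_setU X1 X2)) _; rewrite mulnDr.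
have sYX := leq_mul (leqnn (2 * h ^ 2)) (subset_leq_card (subsetDl Y X1)).
apply: leq_trans (leq_add X1n (leq_trans X2n sYX)) _.
by rewrite -!mulnDl.
Qed.

(** The scales [q], [2 * q], [4 * q] and so on cost a geometric series: [4 * h ^ 2 / q] at the last
    one and half as much at each coarser one, so less than [8 * h ^ 2 / q] per vertex in total. *)
Lemma hyperfinite j q Y :
    0 < q -> components_le Y ((2 ^ j * q) ^ 2) ->
  exists2 X : {set G}, q * #|X| <= 8 * h ^ 2 * #|Y| & components_le (Y :\: X) (q ^ 2).
Proof.
elim: j q Y => [|j IHj] q Y q0 cY.
  by exists set0; rewrite ?cards0 ?muln0 // setD0; move: cY; rewrite mul1n.
have [||X1 X1n cX1] := IHj (2 * q) Y; first by rewrite muln_gt0.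
  by rewrite mulnA -expnSr.
have [X2 X2n cX2] := quarter_components q0 cX1.
exists (X1 :|: X2); last by rewrite -setDDl.
have {}X1n : q * #|X1| <= 4 * h ^ 2 * #|Y|.
  by rewrite -(leq_pmul2l (isT : 0 < 2)) !mulnA; move: X1n; rewrite !mulnA.
apply: leq_trans (leq_mul (leqnn q) (leq_card_setU X1 X2)) _; rewrite mulnDr.
have sYX := leq_mul (leqnn (4 * h ^ 2)) (subset_leq_card (subsetDl Y X1)).
apply: leq_trans (leq_add X1n (leq_trans X2n sYX)) _.
by rewrite -!mulnDl.
Qed.

End Hyperfinite.

End Separator.

Lemma minor_free_hyperfinite (H G : sgraph) q :
    minor_free H G -> 0 < q ->
  exists2 X : {set G}, q * #|X| <= 8 * #|H| ^ 2 * #|G| &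
    components_le (~: X) (q ^ 2).
Proof.
move=> noH q0; suff [X Xn cX] : exists2 X : {set G}, q * #|X| <= 8 * #|H| ^ 2 * #|[set: G]| &
    components_le ([set: G] :\: X) (q ^ 2).
  by exists X; [rewrite cardsT in Xn | rewrite setTD in cX].
(* With [j = #|G|] the initial bound on component sizes exceeds [#|G|] and holds trivially. *)
apply: (@hyperfinite _ _ _ #|G|) => // [P cP|F _ _].
  by rewrite ltnNge; apply: contra noH; apply: covey_minor.
apply: leq_trans (max_card _) _.
apply: leq_trans (ltnW (ltn_expl _ (ltnSn 1))) _.
by rewrite -mulnn -[X in X <= _]muln1 -mulnA leq_mul // !muln_gt0 expn_gt0 q0.
Qed.

Lemma has_minor_induced (H G : sgraph) (B : {set G}) :
  has_minor H (induced B) -> has_minor H G.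
Proof.
case/existsP=> phi /and3P[/forallP cphi /forallP dphi /forallP ephi].
apply/existsP; exists [ffun x => val @: phi x]; apply/and3P; split.
- apply/forallP => x; rewrite ffunE.
  have [/set0Pn[a Aa] _] := connected_setP _ (cphi x).
  apply: (connected_from (imset_f val Aa)) => _ /imsetP[b Ab ->].
  suff /subsetP/(_ b Ab) : phi x \subset
      [set y | connect (edge_in (val @: phi x)) (val a) (val y)] by rewrite inE.
  apply: (connected_sub_closed (cphi x) Aa) => [|u v Au Av].
    by rewrite inE connect0.
  rewrite !inE => au uv; apply: connect_trans au (connect1 _).
  by rewrite /edge_in !imset_f.
- apply/forallP => x; apply/forallP => y; apply/implyP => nxy.
  rewrite !ffunE imset_disjoint; last exact: val_inj.
  by have /forallP/(_ y)/implyP := dphi x; apply.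
- apply/forallP => x; apply/forallP => y; apply/implyP => xy; rewrite !ffunE.
  have /forallP/(_ y)/implyP/(_ xy)/exists_inP[u Au /exists_inP[v Av uv]] := ephi x.
  apply/exists_inP; exists (val u); first exact: imset_f.
  by apply/exists_inP; exists (val v); first exact: imset_f.
Qed.

(** * Analysis of the tester *)

Section WalkCounting.
Variables (G : sgraph) (X : {set G}) (s : G).

Definition lazy_edge : rel G := fun u v => (u == v) || sedge u v.

Lemma lazy_path_component t :
  s \notin X -> path lazy_edge s t -> ~~ has (mem X) t ->
  last s t \in component (~: X) s.
Proof.
move=> nXs; have Cs : s \in ~: X by rewrite inE.
move: (mem_component (~: X) s); move: {1 3 4}s.
elim: t => //= u t IHt v Cv /andP[vu pt]; rewrite negb_or => /andP[nXu nXt].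
apply: IHt => //; case/predU1P: vu => [<-//|]; apply: component_edge => //.
by rewrite inE.
Qed.

(** Fewer than [n / 3] walks end in [T], and at most [ell ^ 13 / 2 <= n / 6] end in the component of
    [s] outside [T]. The remaining walks, at least [n / 2], must meet [X]. *)
Lemma low_clip_visits ell n L (walks : {ffun 'I_n -> L.-tuple G}) (T : {set G})
    (wt := fun v => #|[set i | last s (walks i) == v]|) :
    components_le (~: X) ((ell ^ 3) ^ 2) -> 3 * ell ^ 13 <= n ->
    (forall i, path lazy_edge s (walks i)) ->
    (forall v, v \notin T -> 2 * wt v <= ell ^ 7) ->
    3 * \sum_(v in T) wt v < n ->
  n <= 2 * \sum_(i < n) count (mem X) (s :: walks i).
Proof.
move=> cX ell_n pw light lowT.
have [Xs|nXs] := boolP (s \in X).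
  apply: (@leq_trans (\sum_(i < n) 1)); first by rewrite sum1_card card_ord.
  apply: leq_trans (leq_pmull _ (isT : 0 < 2)).
  by apply: leq_sum => i _; rewrite /= Xs.
have Cs : s \in ~: X by rewrite inE.
set C := component (~: X) s.
have Cle : #|C| <= ell ^ 6.
  have -> : ell ^ 6 = (ell ^ 3) ^ 2 by rewrite -expnM.
  by apply: cX; [exact: component_connected | exact: component_sub].
(* Each walk ends in [C] or visits [X] at least once. *)
have visC : n <= \sum_(v in C) wt v + \sum_(i < n) count (mem X) (s :: walks i).
  have -> : \sum_(v in C) wt v = \sum_(i < n) (last s (walks i) \in C).
    rewrite /wt; under eq_bigr do rewrite -sum1_card big_mkcond /=.
    rewrite exchange_big /=; apply: eq_bigr => i _.
    under eq_bigr do rewrite inE.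
    have [Ci|nCi] := boolP (last s (walks i) \in C).
      rewrite (bigD1 (last s (walks i))) //= eqxx big1 // => v /andP[_].
      by rewrite eq_sym => /negbTE->.
    by rewrite big1 // => v Cv; case: eqP => // vE; rewrite vE Cv in nCi.
  rewrite -big_split /= -[X in X <= _]card_ord -sum1_card; apply: leq_sum => i _.
  have [hX|nhX] := boolP (has (mem X) (walks i)).
    by rewrite has_count in hX; rewrite addnCA addnA ltn_addl // addnC ltn_addr.
  by rewrite lazy_path_component.
have splitC : \sum_(v in C) wt v <= \sum_(v in T) wt v + \sum_(v in C :\: T) wt v.
  rewrite (big_setID T) /= leq_add2r [X in _ <= X](big_setID C) /= setIC.
  exact: leq_addr.
have lightC : 2 * \sum_(v in C :\: T) wt v <= ell ^ 13.
  rewrite big_distrr /=; apply: (@leq_trans (\sum_(v in C :\: T) ell ^ 7)).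
    by apply: leq_sum => v; rewrite inE => /andP[/light].
  rewrite sum_nat_const (_ : 13 = 6 + 7) // expnD leq_mul //.
  by apply: leq_trans Cle; apply: subset_leq_card (subsetDl _ _).
move: visC splitC lightC ell_n lowT; move: (ell ^ 13) => E.
move: (\sum_(v in C) _) (\sum_(v in T) _) (\sum_(v in C :\: T) _) (\sum_i _).
by move=> a b c d; lia.
Qed.

End WalkCounting.

Import Order.TTheory GRing.Theory Num.Theory.
Local Open Scope ring_scope.

(** * Expectations under finite distributions *)

Section Expectation.
Variable R : realType.

Definition expect (T : finType) (p : fdist R T) (f : T -> R) : R :=
  \sum_x p x * f x.

Section Basic.
Variables (T : finType) (p : fdist R T).
Implicit Types f g : T -> R.

Lemma eq_expect f g : f =1 g -> expect p f = expect p g.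
Proof. by move=> fg; apply: eq_bigr => x _; rewrite fg. Qed.

Lemma expect_cst a : expect p (fun=> a) = a.
Proof. by rewrite /expect -mulr_suml mass_sum1 mul1r. Qed.

Lemma expectD f g : expect p (fun x => f x + g x) = expect p f + expect p g.
Proof. by rewrite /expect -big_split; apply: eq_bigr => x _; rewrite mulrDr. Qed.

Lemma expectZ a f : expect p (fun x => a * f x) = a * expect p f.
Proof. by rewrite /expect mulr_sumr; apply: eq_bigr => x _; rewrite mulrCA. Qed.

Lemma expect_sum (I : finType) (F : I -> T -> R) :
  expect p (fun x => \sum_i F i x) = \sum_i expect p (F i).
Proof.
by rewrite /expect exchange_big; apply: eq_bigr => x _; rewrite mulr_sumr.
Qed.

(** Restricting the comparison to the support makes [lazy_walk_path] available: sampled walks follow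
    edges or stay put. *)
Lemma expect_le f g :
  (forall x, 0 < p x -> f x <= g x) -> expect p f <= expect p g.
Proof.
move=> fg; apply: ler_sum => x _; have := mass_ge0 p x; rewrite le_eqVlt.
by case/predU1P=> [<-|px]; rewrite ?mul0r // ler_pM2l // fg.
Qed.

Lemma expect_mass y : expect p (fun x => (x == y)%:R) = p y.
Proof.
rewrite /expect (bigD1 y) //= eqxx mulr1 big1 ?addr0 // => x /negbTE->.
by rewrite mulr0.
Qed.

End Basic.

Lemma expect_ret (T : finType) (a : T) f : expect (ret R a) f = f a.
Proof.
rewrite /expect (bigD1 a) //= /ret_mass eqxx mul1r big1 ?addr0 // => x /negbTE->.
by rewrite mul0r.
Qed.

Lemma expect_bind (S T : finType) (p : fdist R S) (k : S -> fdist R T) f :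
  expect (bind p k) f = expect p (fun x => expect (k x) f).
Proof.
rewrite /expect /= /bind_mass; under eq_bigr do rewrite mulr_suml.
rewrite exchange_big /=; apply: eq_bigr => x _; rewrite mulr_sumr.
by apply: eq_bigr => y _; rewrite mulrA.
Qed.

Lemma bind_gt0 (S T : finType) (p : fdist R S) (k : S -> fdist R T) y :
  0 < bind p k y -> exists x, 0 < p x /\ 0 < k x y.
Proof.
move=> py; have [/existsP[x /andP[px kx]]|/existsPn no] :=
  boolP [exists x, (0 < p x) && (0 < k x y)]; first by exists x.
move: py; rewrite /= /bind_mass big1 ?ltxx // => x _.
have [px|px] := ltP 0 (p x); last first.
  by rewrite (_ : p x = 0) ?mul0r //; apply/le_anti; rewrite px mass_ge0.
have := no x; rewrite px -leNgt => kx.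
by rewrite (_ : k x y = 0) ?mulr0 //; apply/le_anti; rewrite kx mass_ge0.
Qed.

Lemma ret_gt0 (T : finType) (a x : T) : 0 < ret R a x -> x = a.
Proof. by rewrite /= /ret_mass; case: eqP => //; rewrite ltxx. Qed.

Section Independent.
Variables (I T : finType) (p : I -> fdist R T).

Lemma expect_indep_coord i (g : T -> R) :
  expect (indep p) (fun x => g (x i)) = expect (p i) g.
Proof.
(* Absorbing [g] into the [i]-th factor keeps the summand a product over coordinates; the other
   factors sum to 1. *)
pose F j x := p j x * (if j == i then g x else 1).
transitivity (\sum_(x : {ffun I -> T}) \prod_j F j (x j)).
  apply: eq_bigr => x _; rewrite big_split /=; congr (_ * _).
  by rewrite (bigD1 i) //= eqxx big1 ?mulr1 // => j /negbTE->.
rewrite -(bigA_distr_bigA F) (bigD1 i) //= [X in _ * X]big1 ?mulr1.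
  by apply: eq_bigr => x _; rewrite /F eqxx.
by move=> j /negbTE nj; rewrite -[RHS](mass_sum1 (p j)); apply: eq_bigr => x _;
  rewrite /F nj mulr1.
Qed.

Lemma indep_gt0 (x : {ffun I -> T}) i : 0 < indep p x -> 0 < p i (x i).
Proof.
rewrite /= /indep_mass => px; rewrite lt0r mass_ge0 andbT.
by apply: contraTneq px => p0; rewrite (bigD1 i) //= p0 mul0r ltxx.
Qed.

End Independent.

End Expectation.

(** * Lazy walks and their expected visits *)

Section Walks.
Variables (R : realType) (G : sgraph).

Lemma lazy_walk_path L (v : G) t :
  0 < lazy_walk R L v t -> path (@lazy_edge G) v t.
Proof.
elim: L v t => [|L IHL] v t /=; first by move=> _; case: t => -[].
case/bind_gt0=> u [vu /bind_gt0[t' [/IHL pt /ret_gt0->]]] /=; rewrite pt andbT.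
move: vu; rewrite /lazy_edge /= /lazy_step_mass eq_sym.
by case: eqP => //= _; case: (sedge v u); rewrite ?ltxx.
Qed.

(** The transition matrix is symmetric, as every edge has probability [1 / (2 * d)] in both
    directions, so its columns also sum to 1. *)
Lemma sum_expect_lazy_step (g : G -> R) :
  \sum_v expect (lazy_step R v) g = \sum_u g u.
Proof.
rewrite /expect exchange_big; apply: eq_bigr => u _; rewrite -mulr_suml.
rewrite -[RHS]mul1r -(lazy_step_mass_sum1 R u); congr (_ * _).
apply: eq_bigr => v _ /=.
by rewrite /lazy_step_mass eq_sym sedge_sym; case: eqP => // ->.
Qed.

Definition expected_visits L (X : {set G}) v : R :=
  expect (lazy_walk R L v) (fun t => (count (mem X) (v :: t))%:R).

Lemma expected_visitsS L X v : expected_visits L.+1 X v =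
  (v \in X)%:R + expect (lazy_step R v) (expected_visits L X).
Proof.
rewrite /expected_visits /= expect_bind -[in RHS](expect_cst (lazy_step R v) (v \in X)%:R).
rewrite -expectD; apply: eq_expect => u.
rewrite expect_bind -[in RHS](expect_cst (lazy_walk R L u) (v \in X)%:R) -expectD.
by apply: eq_expect => t; rewrite expect_ret /= natrD.
Qed.

(* The uniform distribution is stationary for the lazy walk. *)
Lemma sum_expected_visits L X :
  \sum_v expected_visits L X v = L.+1%:R * #|X|%:R.
Proof.
have sumX : \sum_(v : G) (v \in X)%:R = #|X|%:R :> R.
  by rewrite -sum1_card natr_sum [RHS]big_mkcond; apply: eq_bigr => v _; case: ifP.
elim: L => [|L IHL].
  rewrite mul1r -sumX; apply: eq_bigr => v _.
  by rewrite /expected_visits expect_ret /= addn0.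
under eq_bigr do rewrite expected_visitsS.
rewrite big_split /= sumX sum_expect_lazy_step IHL.
by rewrite -[L.+2%:R]nat1r mulrDl mul1r.
Qed.

End Walks.

(** * Bounding the probability of rejection *)

Section Analysis.
Variables (R : realType) (ell : nat) (H G : sgraph).

(** Markov's inequality in pointwise form: the indicator of [LOW] is at most [2 / n] times the total
    number of visits. The bound [3 <= ell] gives [3 * ell ^ 13 <= ell ^ 14]. *)
Lemma expect_EstClip_low (X : {set G}) (s : G) :
    (3 <= ell)%N -> components_le (~: X) ((ell ^ 3) ^ 2) ->
  expect (EstClip R ell s) (fun b => (b == LOW)%:R) <=
  2 * expected_visits R ell X s.
Proof.
move=> ell3 cX; rewrite /EstClip; move En: (ell ^ 14)%N => n.
have n0 : (0 < n)%N by rewrite -En expn_gt0; case: (ell) ell3.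
have n0R : 0 < n%:R :> R by rewrite ltr0n.
have ->: 2 * expected_visits R ell X s =
    expect (iid n (lazy_walk R ell s)) (fun walks =>
      2 / n%:R * \sum_i (count (mem X) (s :: walks i))%:R).
  rewrite expectZ expect_sum.
  under eq_bigr => i _.
    rewrite (expect_indep_coord (fun=> lazy_walk R ell s) i
               (fun t => (count (mem X) (s :: t))%:R)).
    over.
  by rewrite sumr_const card_ord -[expect _ _ *+ n]mulr_natl mulrA divfK // gt_eqF.
rewrite expect_bind; apply: expect_le => walks pwalks.
rewrite expect_ret; set T := [set v | _].
case: ifP => [_|/negbT]; first by rewrite mulr_ge0 ?sumr_ge0 // divr_ge0.
rewrite -ltNge ltr_pdivlMr // => lowT.
rewrite eqxx mulrAC ler_pdivlMr // mul1r -natr_sum -natrM ler_nat.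
apply: (@low_clip_visits G X s ell n ell walks T) => //.
- by rewrite -En (expnS ell 13) leq_mul.
- by move=> i; apply: lazy_walk_path (indep_gt0 i pwalks).
- move=> v; rewrite inE -ltNge ltr_pdivlMr // mulrC => /ltW.
  by rewrite -natrM ler_nat.
- by rewrite mulnC -(ltr_nat R) natrM.
Qed.

Lemma expect_LocalSearch_found (s : G) : minor_free H G ->
  expect (LocalSearch R ell H s) (fun b => (b == FOUND)%:R) = 0.
Proof.
move=> noH; rewrite /LocalSearch expect_bind.
rewrite -[RHS](expect_cst (iid (ell ^ 21) (lazy_walk R (ell ^ 11) s))).
apply: eq_expect => walks; rewrite expect_ret.
by case: ifP => // /has_minor_induced; rewrite (negbTE noH).
Qed.

(** A union bound and Markov's inequality in pointwise form: one [FOUND], or more than [n] answers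
    [LOW] weighted by [1 / n], already make the sum at least 1. *)
Lemma accept_ge (I : finType) (n : nat) (answers : {ffun I -> bool * bool}) :
    (0 < n)%N ->
  1 - \sum_i (((answers i).1 == LOW)%:R / n%:R + ((answers i).2 == FOUND)%:R)
  <= ((if [exists i, (answers i).2 == FOUND] then REJECT
       else if (n < #|[set i | (answers i).1 == LOW]|)%N then REJECT
       else ACCEPT) == ACCEPT)%:R :> R.
Proof.
move=> n0; have n0R : 0 < n%:R :> R by rewrite ltr0n.
rewrite big_split /= -mulr_suml lerBlDl.
have L0 : 0 <= (\sum_i ((answers i).1 == LOW)%:R) / n%:R :> R.
  by rewrite divr_ge0 ?sumr_ge0.
have F0 : 0 <= \sum_i ((answers i).2 == FOUND)%:R :> R by rewrite sumr_ge0.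
case: existsP => [[i fi]|_].
  rewrite addr0 ler_wpDl // (bigD1 i) //= fi lerDl; exact: sumr_ge0.
case: ifP => [lt|_]; last by rewrite lerDr addr_ge0.
rewrite addr0 ler_wpDr // ler_pdivlMr // mul1r -natr_sum ler_nat.
apply: leq_trans (ltnW lt) _; rewrite -sum1_card big_mkcond /=.
by apply: leq_sum => i _; rewrite inE; case: eqP.
Qed.

Lemma IsMinorFree_accept (G_gt0 : (0 < #|G|)%N) (X : {set G}) :
    (3 <= ell)%N -> minor_free H G -> components_le (~: X) ((ell ^ 3) ^ 2) ->
  1 - (ell * ell.+1)%:R * #|X|%:R / #|G|%:R <= IsMinorFree R ell H G_gt0 ACCEPT.
Proof.
move=> ell3 noH cX; rewrite -expect_mass /IsMinorFree expect_bind.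
have ell0 : (0 < ell)%N by case: (ell) ell3.
have n0 : (0 < 2 * ell ^ 20)%N by rewrite muln_gt0 expn_gt0 ell0.
set n := (2 * ell ^ 20)%N in n0 *; pose N := (ell ^ 21)%N.
have n0R : 0 < n%:R :> R by rewrite ltr0n.
pose low v := 2 * expected_visits R ell X v / n%:R.
(* By stationarity each of the [ell ^ 21] samples contributes [2 * ell.+1 * #|X| / #|G|]; dividing
   by the threshold [2 * ell ^ 20] leaves the factor [ell * ell.+1]. *)
have -> : 1 - (ell * ell.+1)%:R * #|X|%:R / #|G|%:R =
    expect (iid N (uniform R G_gt0)) (fun S => 1 - \sum_i low (S i)).
  under eq_expect do rewrite -mulN1r.
  rewrite expectD expect_cst expectZ mulN1r expect_sum; congr (1 - _).
  under eq_bigr do rewrite (expect_indep_coord (fun=> uniform R G_gt0) _ low).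
  rewrite sumr_const card_ord /expect /= /uniform_mass -mulr_sumr -mulr_suml.
  rewrite -mulr_sumr sum_expected_visits -[RHS]mulr_natr /N /n natrM (natrM _ 2) !natrX.
  have ellR : ell%:R != 0 :> R by rewrite pnatr_eq0 -lt0n.
  have GR : #|G|%:R != 0 :> R by rewrite pnatr_eq0 -lt0n.
  rewrite [_ ^+ 21]exprS; have := expf_neq0 20 ellR.
  by move: (_ ^+ 20) => E E0; field; rewrite E0 GR.
apply: expect_le => S _; rewrite expect_bind.
pose q i := c <- EstClip R ell (S i) ;; f <- LocalSearch R ell H (S i) ;; ret R (c, f).
pose bad (a : bool * bool) : R := (a.1 == LOW)%:R / n%:R + (a.2 == FOUND)%:R.
apply: le_trans (_ : expect (indep q) (fun a => 1 - \sum_i bad (a i)) <= _); last first.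
  by apply: expect_le => a _; rewrite expect_ret accept_ge.
have -> : expect (indep q) (fun a => 1 - \sum_i bad (a i)) =
          1 - \sum_i expect (q i) bad.
  under eq_expect do rewrite -mulN1r.
  rewrite expectD expect_cst expectZ mulN1r expect_sum; congr (1 - _).
  by apply: eq_bigr => i _; rewrite (expect_indep_coord q i bad).
rewrite lerB // ; apply: ler_sum => i _.
have -> : expect (q i) bad =
    expect (EstClip R ell (S i)) (fun b => n%:R^-1 * (b == LOW)%:R).
  rewrite /q expect_bind; apply: eq_expect => c; rewrite expect_bind.
  under eq_expect do rewrite expect_ret /bad /=.
  by rewrite expectD expect_cst expect_LocalSearch_found // addr0 mulrC.
rewrite expectZ mulrC ler_pM2r ?invr_gt0 //.
exact: expect_EstClip_low.
Qed.

End Analysis.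

Theorem theorem2p1 :
  exists alpha : nat,
  forall (R : realType) (r : nat) (H : sgraph) (eps : R)
         (G : sgraph) (G_gt0 : (0 < #|G|)%N),
    (3 <= r)%N -> #|H| = r ->
    0 < eps -> eps <= 1 / 2 ->
    minor_free H G ->
    2 / 3 <= IsMinorFree R (ell_param alpha r eps) H G_gt0 ACCEPT.
Proof.
(* The rejection bound is at most [16 * r ^ 2 / ell]. *)
exists 48%N => R r H eps G G_gt0 r3 Hr _ _ noH.
set ell := ell_param 48 r eps.
have ell_ge : (48 * r ^ 2 <= ell)%N.
  apply: leq_trans (leq_addr _ _); rewrite leq_mul // leq_exp2l //.
  exact: leq_trans r3.
have ell3 : (3 <= ell)%N.
  by apply: leq_trans ell_ge; apply: leq_trans r3 _; rewrite -mulnn; nia.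
have ell0 : (0 < ell)%N by apply: leq_trans ell3.
have ell3_gt0 : (0 < ell ^ 3)%N by rewrite expn_gt0 ell0.
have [X Xn cX] := minor_free_hyperfinite noH ell3_gt0.
apply: le_trans (IsMinorFree_accept R G_gt0 ell3 noH cX).
suff: (3 * (ell * ell.+1 * #|X|))%:R <= #|G|%:R :> R.
  rewrite natrM [(_ * #|X|)%:R]natrM => le; have G0 : 0 < #|G|%:R :> R by rewrite ltr0n.
  suff : (ell * ell.+1)%:R * #|X|%:R / #|G|%:R <= 1 / 3 :> R by lra.
  by rewrite ler_pdivrMr //; lra.
(* Since [ell.+1 <= 2 * ell], the left side times [ell] is at most [6 * ell ^ 3 * #|X|], hence at
   most [48 * r ^ 2 * #|G|]; this is where 48 comes from. *)
rewrite ler_nat -(leq_pmul2l ell0).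
apply: (@leq_trans (48 * r ^ 2 * #|G|)); last by rewrite leq_mul.
have -> : (48 * r ^ 2 * #|G| = 6 * (8 * #|H| ^ 2 * #|G|))%N by rewrite Hr; lia.
apply: leq_trans (leq_mul (leqnn 6) Xn).
apply: (@leq_trans (ell * (3 * (ell * (2 * ell) * #|X|)))).
  by rewrite !leq_mul //; lia.
by rewrite !expnS expn0 muln1; lia.
Qed.
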